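(* Let $t,\lambda$ be positive integers with $t\ge 2$, and let $D$ be a $(t,\lambda)$-liking digraph. Then the following are equivalent: (a) $D$ is isomorphic to $\overleftrightarrow{K}_{t+\lambda}$; (b) $D$ is a $(t-1,\lambda+1)$-liking digraph; (c) $d^+(v)=t+\lambda-1$ for each vertex $v$ of $D$. Furthermore, if $(t,\lambda)\neq(2,1)$, then (a) is equivalent to (d) there is a vertex $v$ with $N^+(v)=V(D)\setminus\{v\}$; and if $t\ge 3$, then (a) is equivalent to (e) $D$ is diregular.
   Context: All digraphs are finite and have no loops and no multiple arcs. For positive integers $t,\lambda$, a digraph $D$ is a $(t,\lambda)$-liking digraph if every set of $t$ distinct vertices of $D$ has exactly $\lambda$ common out-neighbors (the definition presumes $D$ has at least $t$ vertices). $N^+(v)$ is the out-neighborhood of $v$, $d^+(v)$ its out-degree and $d^-(v)$ its in-degree. A digraph is $k$-diregular if every vertex has out-degree $k$ and in-degree $k$, and diregular if it is $k$-diregular for some positive integer $k$. $\overleftrightarrow{K}_n$ denotes the complete digraph on $n$ vertices (both arcs between every pair of distinct vertices). *)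

(* Defs.v *)
From mathcomp Require Import all_boot.
Set Implicit Arguments.
Unset Strict Implicit.
Unset Printing Implicit Defensive.

Record digraph := Digraph {
  vertex :> finType;
  arc : rel vertex;
  arc_irrefl : irreflexive arc }.

Definition outN (D : digraph) (v : D) : {set D} := [set w | arc v w].
Definition inN (D : digraph) (v : D) : {set D} := [set w | arc w v].

Definition outdeg (D : digraph) (v : D) : nat := #|outN v|.
Definition indeg (D : digraph) (v : D) : nat := #|inN v|.

Definition common_outN (D : digraph) (S : {set D}) : {set D} :=
  [set w | [forall v in S, arc v w]].

(* The bound t <= #|D| rules out the vacuous case in which D has no set of
   t vertices. *)
Definition liking (t lambda : nat) (D : digraph) : Prop :=
  t <= #|D| /\
  forall S : {set D}, #|S| = t -> #|common_outN S| = lambda.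

Definition kdiregular (k : nat) (D : digraph) : Prop :=
  forall v : D, outdeg v = k /\ indeg v = k.

Definition diregular (D : digraph) : Prop :=
  exists2 k : nat, 0 < k & kdiregular k D.

Definition complete_arc (n : nat) : rel 'I_n := fun i j => i != j.

Lemma complete_arc_irrefl (n : nat) : irreflexive (@complete_arc n).
Proof. by move=> i; rewrite /complete_arc eqxx. Qed.

Definition complete_digraph (n : nat) : digraph :=
  Digraph (@complete_arc_irrefl n).

Definition digraph_iso (D1 D2 : digraph) : Prop :=
  exists2 f : D1 -> D2, bijective f & forall x y : D1, arc (f x) (f y) = arc x y.

(* Main.v *)
(** For [t >= 3] every [(t, lambda)]-liking digraph is already complete: fix a
    set [A] of [t - 2] vertices with set [W] of common out-neighbors.  The sets
    [N+(x) :&: W], [x] outside [A], pairwise meet in [lambda] elements, and each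
    has more than [lambda] elements (otherwise it would be contained in all the
    others, so that its elements would carry loops).  Fisher's inequality gives
    [#|~: A| <= #|W|], that is [W = ~: A].  For [t = 2], (c) gives
    sets [N+(x)] of size [lambda + 1] pairwise meeting in [lambda] elements; in
    (d), deleting the dominating vertex gives sets of size [lambda] pairwise
    meeting in [lambda - 1] elements.  In such a family fix [u]: every [x != u]
    misses exactly one element of [N+(u)], and two vertices missing different
    elements have the same unique out-neighbor [o] outside [N+(u)].  Hence all
    [x != u] share [o], and [o = u] because [o] has no loop. *)
From mathcomp Require Import all_boot all_order all_algebra.
From mathcomp Require Import zify.
Require Import Defs.

Set Implicit Arguments.
Unset Strict Implicit.
Unset Printing Implicit Defensive.

Lemma subset_card_between (T : finType) (A B : {set T}) (k : nat) :
  A \subset B -> #|A| <= k <= #|B| ->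
  exists C : {set T}, [/\ A \subset C, C \subset B & #|C| = k].
Proof.
move=> sAB /andP[]; elim: k => [|k IHk] leAk lekB.
  by exists A; split=> //; apply/eqP; rewrite -leqn0.
move: leAk; rewrite leq_eqVlt => /predU1P[cA|]; first by exists A.
rewrite ltnS => /IHk/(_ (ltnW lekB))[C [sAC sCB cC]].
have /subsetPn[x xB xC] : ~~ (B \subset C).
  by apply: contraL lekB => /subset_leq_card; rewrite cC -leqNgt.
exists (x |: C); split; last by rewrite cardsU1 xC cC.
  exact: subset_trans sAC (subsetUr _ _).
by rewrite subUset sub1set xB.
Qed.

(** * The nonuniform Fisher inequality *)

Section Fisher.
Import GRing.Theory Num.Theory Order.TTheory.
Local Open Scope ring_scope.

(** The rows of the incidence matrix are independent: in a vanishing combination, [rel] gives every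
    coefficient the sign opposite to their sum [S]. This forces [S = 0], and then each coefficient
    is zero. *)
Lemma fisher_inequality (T : finType) (m l : nat) (W : {set T})
    (F : 'I_m -> {set T}) :
  (forall i, F i \subset W) -> (forall i, l < #|F i|)%N ->
  (forall i j, i != j -> #|F i :&: F j| = l) -> (m <= #|W|)%N.
Proof.
move=> FW Fgt FI.
pose M : 'M[rat]_(m, #|W|) := \matrix_(i, k) (enum_val k \in F i)%:R.
suff: row_free M by rewrite /row_free => /eqP <-; exact: rank_leq_col.
apply: inj_row_free => c cM0.
have sum0 x : x \in W -> \sum_i c 0 i * (x \in F i)%:R = 0.
  move=> xW; have /matrixP/(_ 0 (enum_rank_in xW x)) := cM0.
  by rewrite !mxE; under eq_bigr do rewrite mxE enum_rankK_in //.
pose S := \sum_i c 0 i.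
(* summing [sum0] over [x \in F j] *)
have rel j : l%:R * S + c 0 j * (#|F j| - l)%:R = 0.
  have : \sum_(x in F j) \sum_i c 0 i * (x \in F i)%:R = 0.
    by apply: big1 => x /(subsetP (FW j)) /sum0.
  rewrite exchange_big /= => <-.
  have cardE i : \sum_(x in F j) c 0 i * (x \in F i)%:R
      = c 0 i * #|F i :&: F j|%:R.
    rewrite -mulr_sumr -sum1_card natr_sum; congr (_ * _).
    rewrite big_mkcond [RHS]big_mkcond; apply: eq_bigr => x _.
    by rewrite inE; case: (x \in F i); case: (x \in F j).
  under eq_bigr do rewrite cardE.
  rewrite (bigD1 j) //= setIid /S (bigD1 j) //= mulrDr mulr_sumr.
  rewrite (natrB _ (ltnW (Fgt j))) mulrBr addrAC [l%:R * c 0 j]mulrC.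
  rewrite addrCA subrr addr0; congr (_ + _).
  by apply: eq_bigr => i ij; rewrite FI // mulrC.
have gap j : 0 < (#|F j| - l)%:R :> rat by rewrite ltr0n subn_gt0.
have S0 : S = 0.
  (* [S ^ 2] is the sum of the [c 0 j * S]. By [rel], such a term times the positive [#|F j| - l]
     equals [- l * S ^ 2], so no term is positive. *)
  apply/eqP; rewrite -sqrf_eq0 eq_le sqr_ge0 andbT expr2 {1}/S mulr_suml.
  apply: sumr_le0 => j _; rewrite -(pmulr_lle0 _ (gap j)) mulrAC.
  have /eqP := rel j; rewrite addrC addr_eq0 => /eqP ->.
  by rewrite mulNr oppr_le0 -mulrA mulr_ge0 ?ler0n // -expr2 sqr_ge0.
apply/rowP => j; rewrite mxE; apply/eqP.
have /eqP := rel j; rewrite S0 mulr0 add0r mulf_eq0 => /orP[//|].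
by rewrite (gt_eqF (gap j)).
Qed.
End Fisher.

(** * Families of sets of size [l + 1] meeting pairwise in [l] elements *)

(** The ground set [W] is a parameter because (c) uses all vertices, whereas (d) uses all but the
    dominating one. *)
Lemma near_uniform_complete (T : finType) (W : {set T}) (N : T -> {set T})
    (l : nat) :
  0 < l -> (forall x, x \in W -> N x \subset W) ->
  (forall x, x \in W -> x \notin N x) ->
  (forall x, x \in W -> #|N x| = l.+1) ->
  (forall x y, x \in W -> y \in W -> x != y -> #|N x :&: N y| = l) ->
  forall x y, x \in W -> y \in W -> x != y -> y \in N x.
Proof.
move=> l0 NW Nirr cN cNI w u wW uW wu.
have inC x : x \in N u -> [/\ x \in W, x != u & x \notin N x].
  move=> xu; have xW := subsetP (NW u uW) x xu; split=> //; last exact: Nirr.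
  by apply: contraTneq xu => ->; apply: Nirr.
(* every [x != u] misses exactly one element of [N u], and has exactly one
   out-neighbor outside [N u] *)
have out1 x : x \in W -> x != u -> #|N x :\: N u| = 1.
  by move=> xW xu; have := cardsID (N u) (N x); rewrite cN // cNI //; lia.
have miss1 x : x \in W -> x != u -> #|N u :\: N x| = 1.
  move=> xW xu; have := cardsID (N x) (N u).
  by rewrite cN // cNI // 1?eq_sym //; lia.
have same x y : x \in W -> y \in W -> x != u -> y != u ->
    N u :\: N x != N u :\: N y -> N x :\: N u = N y :\: N u.
  move=> xW yW xu yu dm.
  have xy : x != y by apply: contraNneq dm => ->.
  have /cards1P[a ea] : #|N x :\: N u| == 1 by rewrite out1.
  have /cards1P[b eb] : #|N y :\: N u| == 1 by rewrite out1.
  (* If [a != b], then [N x :&: N y] lies inside [N u] and avoids both [p] and [q], so it has only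
     [l - 1] elements. *)
  rewrite ea eb; apply/eqP; apply: contraT => ab.
  have I0 : (N x :&: N y) :\: N u = set0.
    apply/setP => z; rewrite setDIl ea eb !inE.
    by apply/negP => /andP[/eqP -> /eqP eab]; rewrite eab eqxx in ab.
  have /cards1P[p ep] : #|N u :\: N x| == 1 by rewrite miss1.
  have /cards1P[q eq] : #|N u :\: N y| == 1 by rewrite miss1.
  have pq : p != q by apply: contraNneq dm => pq; rewrite ep eq pq.
  have := cardsID (N x :&: N y) (N u); have := cardsID (N u) (N x :&: N y).
  by rewrite I0 cards0 setDIr ep eq cards2 pq cN // cNI // setIC; lia.
have [x [y [xC yC xy]]] : exists x y, [/\ x \in N u, y \in N u & x != y].
  by apply/card_gt1P; rewrite cN.
(* Having no loop, [z] is itself the one element that it misses. *)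
have missE z : z \in N u -> N u :\: N z = [set z].
  move=> zC; have [zW zu zz] := inC z zC; apply/esym/eqP.
  by rewrite eqEcard sub1set inE zz zC cards1 miss1.
have [xW xu xx] := inC x xC; have [yW yu yy] := inC y yC.
have exy : N x :\: N u = N y :\: N u.
  by apply: same => //; rewrite !missE // (inj_eq set1_inj).
have /cards1P[o eo] : #|N x :\: N u| == 1 by rewrite out1.
(* [x] and [y] miss different elements, so [z] differs in this respect from at least one of them. *)
have allo z : z \in W -> z != u -> N z :\: N u = [set o].
  move=> zW zu.
  have [mzx|mzx] := eqVneq (N u :\: N z) (N u :\: N x); last first.
    by rewrite (same z x).
  by rewrite (same z y) -?exy // mzx !missE // (inj_eq set1_inj).
have oN z : z \in W -> z != u -> o \in N z.
  by move=> zW zu; have := set11 o; rewrite -(allo z) // inE => /andP[].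
have oW : o \in W by apply: subsetP (NW x xW) _ (oN x xW xu).
have [<-|ou] := eqVneq o u; first exact: oN.
by have := Nirr o oW; rewrite oN.
Qed.

(** * Common out-neighborhoods in liking digraphs *)

Lemma common_outN_disjoint (D : digraph) (S : {set D}) :
  common_outN S \subset ~: S.
Proof.
apply/subsetP => x; rewrite !inE => /forall_inP Sx.
by apply/negP => /Sx; rewrite arc_irrefl.
Qed.

Lemma common_outN_setU1 (D : digraph) (x : D) (S : {set D}) :
  common_outN (x |: S) = outN x :&: common_outN S.
Proof.
apply/setP => w; rewrite !inE; apply/forall_inP/andP => [xSw | [xw /forall_inP Sw] v].
  split; first by apply: xSw; rewrite !inE eqxx.
  by apply/forall_inP => v vS; apply: xSw; rewrite !inE vS orbT.
by rewrite !inE => /predU1P[->|/Sw].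
Qed.

Lemma common_outN1 (D : digraph) (x : D) : common_outN [set x] = outN x.
Proof.
apply/setP => w; rewrite !inE; apply/forall_inP/idP => [-> //|xw v].
  by rewrite inE.
by rewrite inE => /eqP ->.
Qed.

Lemma card_common_outN_setU2 (t l : nat) (D : digraph) (A : {set D}) (x y : D) :
  liking t.+2 l D -> #|A| = t -> x \notin A -> y \notin A -> x != y ->
  #|common_outN A :&: outN x :&: outN y| = l.
Proof.
move=> [_ lD] cA xA yA xy; rewrite -setIA setIC -setIA.
rewrite -[outN y :&: _]common_outN_setU1 -common_outN_setU1 lD //.
by rewrite !cardsU1 !inE negb_or xy xA yA cA.
Qed.

Lemma common_outN_gt (t l : nat) (D : digraph) (A : {set D}) (x : D) :
  0 < l -> liking t.+2 l D -> #|A| = t -> x \notin A ->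
  l < #|common_outN A :&: outN x|.
Proof.
move=> l0 lD cA xA; rewrite ltnNge; apply/negP => le.
have cI := card_common_outN_setU2 lD cA xA.
have sub z : z \notin A -> x != z -> common_outN A :&: outN x \subset outN z.
  move=> zA xz; apply/setIidPl/eqP; rewrite eqEcard subsetIl.
  by rewrite (cI z).
have [z] : exists z, z \in common_outN A :&: outN x.
  (* [D] has at least [t + 2] vertices and [x |: A] only [t + 1]. *)
  have [y] : exists y, y \in ~: (x |: A).
    apply/card_gt0P; have := cardsC (x |: A); rewrite cardsU1 xA cA.
    by case: lD; lia.
  rewrite !inE negb_or eq_sym => /andP[xy yA].
  have /card_gt0P[z] : 0 < #|common_outN A :&: outN x :&: outN y| by rewrite cI.
  by rewrite inE => /andP[zAx _]; exists z.
move=> zAx; have [zA zx] := setIP zAx.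
have zA' : z \notin A by have /subsetP/(_ z zA) := common_outN_disjoint A; rewrite inE.
have xz : x != z by apply: contraTneq zx => <-; rewrite inE arc_irrefl.
by have /subsetP/(_ z zAx) := sub z zA' xz; rewrite inE arc_irrefl.
Qed.

Definition complete (D : digraph) := forall x y : D, x != y -> arc x y.

Lemma liking3_complete (t l : nat) (D : digraph) :
  2 < t -> 0 < l -> liking t l D -> complete D.
Proof.
case: t => [|[|[|t]]] // _ l0 lD a b ab.
(* [t] is now the original one minus 3, so [A] has the size required in the Fisher argument. It
   contains [a] and avoids [b], hence [common_outN A = ~: A] yields the arc from [a] to [b]. *)
have [||A [aA bA cA]] := @subset_card_between _ [set a] [set~ b] t.+1.
- by rewrite sub1set !inE.
- by rewrite cards1 cardsC1; case: lD; lia.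
have cI x y := @card_common_outN_setU2 _ _ _ A x y lD cA.
have leW : #|~: A| <= #|common_outN A|.
  apply: (@fisher_inequality _ _ l _ (fun i => common_outN A :&: outN (enum_val i))).
  - by move=> i; apply: subsetIl.
  - move=> i; apply: common_outN_gt lD cA _ => //.
    by have := enum_valP i; rewrite inE.
  move=> i j ij; rewrite setIACA setIid setIA cI ?(inj_eq enum_val_inj) //.
    by have := enum_valP i; rewrite inE.
  by have := enum_valP j; rewrite inE.
have WE : common_outN A = ~: A by apply/eqP; rewrite eqEcard common_outN_disjoint.
have : b \in common_outN A.
  by rewrite WE inE; apply/negP => /(subsetP bA); rewrite !inE eqxx.
by rewrite inE => /forall_inP; apply; rewrite (subsetP aA) ?set11.
Qed.

(** * The case [t = 2] *)

Lemma liking2_outN (l : nat) (D : digraph) (x y : D) :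
  liking 2 l D -> x != y -> #|outN x :&: outN y| = l.
Proof.
move=> [_ lD] xy; have := lD [set x; y].
by rewrite cards2 xy common_outN_setU1 common_outN1 => ->.
Qed.

Lemma liking2_outdeg_complete (l : nat) (D : digraph) :
  0 < l -> liking 2 l D -> (forall v : D, outdeg v = l.+1) -> complete D.
Proof.
move=> l0 lD dD x y xy; suff: y \in outN x by rewrite inE.
apply: (@near_uniform_complete _ [set: D] _ l) => //.
- by move=> z _; rewrite inE arc_irrefl.
- by move=> z _; apply: dD.
by move=> z w _ _; apply: liking2_outN.
Qed.

Lemma liking2_dominating_complete (l : nat) (D : digraph) (v : D) :
  1 < l -> liking 2 l D -> outN v = [set: D] :\ v -> complete D.
Proof.
move=> l1 lD Nv.
have vout x : x != v -> arc v x.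
  by move=> xv; suff: x \in outN v; [rewrite inE | rewrite Nv !inE xv].
have cNv x : x != v -> #|outN x :\ v| = l.
  by move=> xv; rewrite -(liking2_outN lD xv) Nv setTD setDE.
have toV x : x != v -> arc x v.
  (* With [A] empty, [outN x] has more than [l] elements, but only [l] of them differ from [v]. *)
  move=> xv; have := @common_outN_gt 0 l D set0 x (ltnW l1) lD (cards0 _).
  rewrite inE => /(_ isT) /leq_trans/(_ (subset_leq_card (subsetIr _ _))).
  by rewrite (cardsD1 v) cNv // inE; case: (arc x v); rewrite ?ltnn.
move=> x y xy.
have [xv|xv] := eqVneq x v; first by rewrite xv vout // -xv eq_sym.
have [->|yv] := eqVneq y v; first exact: toV.
suff: y \in outN x :\ v by rewrite !inE => /andP[].
(* Every [x != v] has an arc to [v], so deleting [v] lowers set sizes and pairwise intersections by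
   one. Positivity of [l.-1] is where [1 < l] enters. *)
apply: (@near_uniform_complete _ [set~ v] (fun x => outN x :\ v) l.-1);
  rewrite ?inE //; first by lia.
- by move=> z _; apply/subsetP => w; rewrite !inE => /andP[].
- by move=> z _; rewrite !inE arc_irrefl andbF.
- by move=> z; rewrite !inE => zv; rewrite cNv //; lia.
move=> z w; rewrite !inE => zv wv zw; rewrite -setDIl.
have := liking2_outN lD zw; rewrite (cardsD1 v) !inE !toV //=; lia.
Qed.

(** * Complete digraphs *)

Lemma complete_common_outN (D : digraph) (S : {set D}) :
  complete D -> common_outN S = ~: S.
Proof.
move=> cD; apply/eqP; rewrite eqEsubset common_outN_disjoint.
apply/subsetP => x; rewrite !inE => xS; apply/forall_inP => v vS.
by apply: cD; apply: contraNneq xS => <-.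
Qed.

Lemma complete_liking_card (t l : nat) (D : digraph) :
  complete D -> liking t l D -> #|D| = t + l.
Proof.
move=> cD [tD lD].
have [|S [_ _ cS]] := @subset_card_between D set0 setT t (sub0set _).
  by rewrite cards0 cardsT.
by rewrite -(cardsC S) cS -(lD S cS) complete_common_outN.
Qed.

Lemma complete_outN (D : digraph) (v : D) : complete D -> outN v = [set~ v].
Proof. by move=> cD; rewrite -common_outN1 complete_common_outN. Qed.

Lemma complete_inN (D : digraph) (v : D) : complete D -> inN v = [set~ v].
Proof.
move=> cD; apply/setP => x; rewrite !inE.
have [->|xv] := eqVneq x v; first by rewrite arc_irrefl.
by rewrite cD.
Qed.

Lemma iso_completeP (n : nat) (D : digraph) :
  #|D| = n -> complete D -> digraph_iso D (complete_digraph n).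
Proof.
move=> <- cD; exists enum_rank; first exact: enum_rank_bij.
move=> x y; rewrite /= /complete_arc (inj_eq enum_rank_inj).
by have [->|xy] := eqVneq x y; rewrite ?arc_irrefl ?cD.
Qed.

Lemma iso_complete (n : nat) (D : digraph) :
  digraph_iso D (complete_digraph n) -> complete D.
Proof.
by move=> [f /bij_inj injf fD] x y xy; rewrite -fD /= /complete_arc (inj_eq injf).
Qed.

(** * The equivalences *)

Theorem theorem1p2 (t lambda : nat) (ht : 2 <= t) (hlambda : 1 <= lambda)
    (D : digraph) (hD : liking t lambda D) :
  (digraph_iso D (complete_digraph (t + lambda)) <->
     liking t.-1 lambda.+1 D) /\
  (digraph_iso D (complete_digraph (t + lambda)) <->
     forall v : D, outdeg v = t + lambda - 1) /\
  ((t, lambda) <> (2, 1) ->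
     (digraph_iso D (complete_digraph (t + lambda)) <->
        exists v : D, outN v = [set: D] :\ v)) /\
  (3 <= t ->
     (digraph_iso D (complete_digraph (t + lambda)) <-> diregular D)).
Proof.
have toiso : complete D -> digraph_iso D (complete_digraph (t + lambda)).
  by move=> cD; apply: iso_completeP => //; apply: complete_liking_card hD.
have deg_complete : (forall v : D, outdeg v = t + lambda - 1) -> complete D.
  move=> degD; case: (ltnP 2 t) => t2; first exact: liking3_complete hD.
  have tE : t = 2 by lia.
  apply: (@liking2_outdeg_complete lambda) => [//||v]; first by rewrite -tE.
  by rewrite degD; lia.
split; [split | split; [split | split => [tl | t3]; split]].
- move=> /iso_complete cD; have cardD := complete_liking_card cD hD.
  split=> [|S cS]; first by lia.
  by rewrite complete_common_outN //; have := cardsC S; lia.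
- move=> hb; apply: toiso; case: (ltnP 2 t) => t2.
    exact: liking3_complete hD.
  have tE : t = 2 by lia.
  (* For [t = 2], condition (b) on singletons is exactly the out-degree condition (c). *)
  apply: deg_complete => v; rewrite /outdeg -common_outN1.
  by case: hb => _ ->; rewrite ?cards1; lia.
- move=> /iso_complete cD v; have cardD := complete_liking_card cD hD.
  by rewrite /outdeg complete_outN // cardsC1; lia.
- by move=> degD; apply/toiso/deg_complete.
- move=> /iso_complete cD.
  have /card_gt0P[v _] : 0 < #|D| by case: hD; lia.
  by exists v; rewrite complete_outN //; apply/setP => x; rewrite !inE andbT.
- move=> [v Nv]; apply: toiso; case: (ltnP 2 t) => t2.
    exact: liking3_complete hD.
  have tE : t = 2 by lia.
  apply: (@liking2_dominating_complete lambda _ v) => //; last by rewrite -tE.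
  by rewrite ltn_neqAle hlambda andbT; apply/eqP => l1; apply: tl; rewrite tE -l1.
- move=> /iso_complete cD; have cardD := complete_liking_card cD hD.
  exists (t + lambda - 1); first by lia.
  by move=> v; rewrite /outdeg /indeg complete_outN ?complete_inN // cardsC1; lia.
- by move=> _; apply: toiso; apply: liking3_complete hD.
Qed.
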